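(* Let $P$ be a poset such that for no integer $k\geq 2$ does $P$ have an embedded $P_k$, where $P_k$ denotes the subdivided $k$-crown. Then $\operatorname{qn}(P)$ is at most the width of $P$.
   Context: All posets are finite and nonempty. For elements $a,b$ of a poset $P$, write $a \prec b$ (a cover relation, or cover) if $a<b$ and there is no $c\in P$ with $a<c<b$. The width of $P$ is the maximum number of pairwise incomparable elements. A linear extension $L$ of $P$ is a linear order on the elements of $P$ such that $x<_L y$ whenever $x<_P y$. A rainbow of size $k$ (a $k$-rainbow) with respect to $L$ is a set of $k$ covers $a_1\prec b_1,\dots,a_k\prec b_k$ of $P$ with $a_1<_L\cdots<_L a_k<_L b_k<_L\cdots<_L b_1$. The queue-number $\operatorname{qn}(P)$ is the smallest $k$ such that there is a linear extension $L$ of $P$ with respect to which the covers of $P$ contain no $(k+1)$-rainbow. For an integer $k\geq 2$, the subdivided $k$-crown is the poset $P_k$ with $3k$ elements $a_1,\dots,a_k,b_1,\dots,b_k,c_1,\dots,c_k$ whose cover relations are exactly: $a_i\prec b_i$ and $b_i\prec c_i$ for $i=1,\dots,k$; $a_i\prec c_{i-1}$ for $i=2,\dots,k$; and $a_1\prec c_k$. The covers of the form $a_i\prec c_j$ are called the diagonal covers of $P_k$. A poset $P$ has an embedded $P_k$ if $P$ contains $3k$ elements that induce a copy of $P_k$ in $P$ (as an induced subposet) such that all diagonal covers of that copy are covers of $P$. *)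

(* Defs.v *)
From HB Require Import structures.
From mathcomp Require Import all_boot all_order.

Set Implicit Arguments.
Unset Strict Implicit.
Unset Printing Implicit Defensive.

Import Order.TTheory.

Section Posets.
Context {d : Order.disp_t} {P : finPOrderType d}.

Definition covers (a b : P) : bool :=
  (a < b)%O && ~~ [exists c : P, (a < c < b)%O].

Definition antichain (A : {set P}) : bool :=
  [forall x in A, forall y in A, (x != y) ==> (x >< y)%O].

(* [(x, y) \in L] stands for x <_L y: a linear order is represented by the
   graph of its strict part. *)
Definition linear_extension (L : {set P * P}) : bool :=
  [&& [forall x, (x, x) \notin L],
      [forall x, forall y, forall z,
         ((x, y) \in L) && ((y, z) \in L) ==> ((x, z) \in L)],
      [forall x, forall y, (x != y) ==> ((x, y) \in L) || ((y, x) \in L)] &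
      [forall x, forall y, (x < y)%O ==> ((x, y) \in L)]].

(* The chain a_1 <_L ... <_L a_k <_L b_k <_L ... <_L b_1. *)
Definition rainbow (L : {set P * P}) (k : nat) (a b : k.-tuple P) : bool :=
  [forall i, covers (tnth a i) (tnth b i)]
  && sorted [rel x y | (x, y) \in L] (a ++ rev b).

Definition has_rainbow (L : {set P * P}) (k : nat) : bool :=
  [exists a : k.-tuple P, exists b : k.-tuple P, rainbow L a b].

End Posets.

Definition width {d : Order.disp_t} (P : finPOrderType d) : nat :=
  \max_(A : {set P} | antichain A) #|A|.

Definition queue_layout {d : Order.disp_t} (P : finPOrderType d) (k : nat) :=
  [exists L : {set P * P}, linear_extension L && ~~ has_rainbow L k.+1].

Lemma linear_extension_exists {d : Order.disp_t} (P : finPOrderType d) :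
  exists L : {set P * P}, linear_extension L.
Proof.
pose h (x : P) := #|[set z | (z < x)%O]|.
have hlt x y : (x < y)%O -> h x < h y.
  move=> xy; apply/proper_card/properP; split.
    by apply/subsetP => z; rewrite !inE => zx; apply: lt_trans xy.
  by exists x; rewrite !inE ?ltxx.
pose r (x y : P) :=
  (h x < h y) || (h x == h y) && (enum_rank x < enum_rank y)%N.
exists [set p | r p.1 p.2]; apply/and4P; split.
- by apply/forallP => x; rewrite inE /r !ltnn andbF.
- apply/forallP => x; apply/forallP => y; apply/forallP => z.
  rewrite !inE /r /=; apply/implyP => /andP[].
  move=> /orP[xy|/andP[/eqP-> xy]] /orP[yz|/andP[/eqP<- yz]].
  + by rewrite (ltn_trans xy yz).
  + by rewrite xy.
  + by rewrite yz.
  + by rewrite eqxx (ltn_trans xy yz) orbT.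
- apply/forallP => x; apply/forallP => y; apply/implyP => xy.
  rewrite !inE /r /=; case: (ltngtP (h x) (h y)) => //= _.
  rewrite -neq_ltn; apply: contra xy => /eqP e.
  by apply/eqP/enum_rank_inj/val_inj.
- apply/forallP => x; apply/forallP => y; apply/implyP => xy.
  by rewrite inE /r hlt.
Qed.

Lemma queue_layout_exists {d : Order.disp_t} (P : finPOrderType d) :
  exists k, queue_layout P k.
Proof.
have [L Lext] := linear_extension_exists P; exists #|P|.
apply/existsP; exists L; rewrite Lext /=.
apply/existsP => -[a /existsP[b /andP[_ s]]].
have/and4P[/forallP irr /forallP tr _ _] := Lext.
have u : uniq (a ++ rev b).
  apply: sorted_uniq s => [y x z /= xy yz|x /=]; last exact/negbTE/irr.
  have /forallP/(_ y)/forallP/(_ z)/implyP := tr x.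
  by apply; rewrite xy yz.
move: u; rewrite cat_uniq => /andP[ua _].
by have := max_card (mem a); rewrite (card_uniqP ua) size_tuple ltnn.
Qed.

Definition queue_number {d : Order.disp_t} (P : finPOrderType d) : nat :=
  ex_minn (queue_layout_exists P).

(* The elements a_i, b_i, c_i of the subdivided k-crown, with indices shifted
   to 0, ..., k - 1. *)
Inductive crown (k : nat) : Type :=
  CrownA of 'I_k | CrownB of 'I_k | CrownC of 'I_k.
Arguments CrownA {k}.
Arguments CrownB {k}.
Arguments CrownC {k}.

Section Crown.
Variable k : nat.

Definition crown_code (x : crown k) : 'I_k + 'I_k + 'I_k :=
  match x with
  | CrownA i => inl (inl i) | CrownB i => inl (inr i) | CrownC i => inr i
  end.

Definition crown_decode (u : 'I_k + 'I_k + 'I_k) : crown k :=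
  match u with
  | inl (inl i) => CrownA i | inl (inr i) => CrownB i | inr i => CrownC i
  end.

Lemma crown_codeK : cancel crown_code crown_decode.
Proof. by case. Qed.

HB.instance Definition _ := Finite.copy (crown k) (can_type crown_codeK).

(* [ord_pred] is the cyclic predecessor: it sends 0 to k - 1. *)
Definition crown_cover (x y : crown k) : bool :=
  match x, y with
  | CrownA i, CrownB j => i == j
  | CrownB i, CrownC j => i == j
  | CrownA i, CrownC j => j == ord_pred i
  | _, _ => false
  end.

Definition crown_le : rel (crown k) := connect crown_cover.

Definition crown_le_explicit (x y : crown k) : bool :=
  match x, y with
  | CrownA i, CrownA j | CrownB i, CrownB j | CrownC i, CrownC j
  | CrownA i, CrownB j | CrownB i, CrownC j => i == j
  | CrownA i, CrownC j => (i == j) || (j == ord_pred i)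
  | _, _ => false
  end.

Lemma crown_leE : crown_le =2 crown_le_explicit.
Proof.
move=> x y; apply/idP/idP.
  case/connectP => p + ->; elim: p x => [|z p IH] x /=; first by case: x => /=.
  case/andP => xz /IH; move: (last z p) => w {IH}.
  case: x z w xz => [] i [] j [] l //= /eqP-> //.
    by move=> ->.
  by move=> /eqP->; rewrite eqxx orbT.
case: x y => [] i [] j //=; try by move/eqP->; apply: connect0.
- by move=> ij; apply: connect1.
- case/orP => [/eqP<-|ij]; last exact: connect1.
  by apply: (@connect_trans _ _ (CrownB i)); apply: connect1 => /=.
- by move=> ij; apply: connect1.
Qed.

Lemma crown_le_refl : reflexive crown_le.
Proof. exact: connect0. Qed.

Lemma crown_le_anti : antisymmetric crown_le.
Proof.
by move=> [] i [] j; rewrite !crown_leE /= ?andbF // => /andP[/eqP->].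
Qed.

Lemma crown_le_trans : transitive crown_le.
Proof. exact: connect_trans. Qed.

Definition crown_display : Order.disp_t := Order.Disp tt tt.

HB.instance Definition _ := Order.Le_isPOrder.Build crown_display (crown k)
  crown_le_refl crown_le_anti crown_le_trans.

Lemma covers_crown (x y : crown k) : 1 < k -> covers x y = crown_cover x y.
Proof.
move=> k_gt1; apply/andP/idP.
  case=> xy /existsP nz; have /connectP[] := ltW xy => -[|z p] /=.
    by move=> _ e; rewrite e ltxx in xy.
  case/andP=> xz pz ey; suff -> : y = z by [].
  apply/eqP; case: eqP => // /eqP yz; case: nz; exists z.
  apply/andP; split; rewrite lt_neqAle.
    apply/andP; split; last exact: connect1.
    by case: x z xz {xy pz ey yz} => [] i [] j.
  by rewrite eq_sym yz; apply/connectP; exists p.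
have leE (u v : crown k) : (u <= v)%O = crown_le_explicit u v := crown_leE u v.
move=> xy; split.
  rewrite lt_neqAle leE.
  by case: x y xy => [] i [] j //= ->; rewrite ?orbT.
apply/existsP => -[z]; rewrite !lt_neqAle !leE.
move=> /andP[/andP[n1 e1] /andP[n2 e2]].
case: x z y xy n1 e1 n2 e2 => [] i [] l [] j // e n1 e1 n2 e2;
  try (by rewrite (eqP e1) eqxx in n1); try (by rewrite (eqP e2) eqxx in n2).
move: e; rewrite /= in e1 e2 *.
rewrite -(eqP e2) -(eqP e1) => /eqP/(congr1 val) /=.
have ik := ltn_ord i; case: i ik {n1 n2 e1 e2} => [[|i] /= lt_i _].
  rewrite add0n modn_small ?prednK ?(ltn_trans _ k_gt1) //.
  by case: (k) k_gt1 => [|[]].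
by rewrite modnDr modn_small ?(ltnW lt_i) // => /eqP; rewrite eqn_leq ltnn.
Qed.

End Crown.

Definition has_embedded_crown {d : Order.disp_t} (P : finPOrderType d)
    (k : nat) : Prop :=
  exists f : crown k -> P,
    [/\ injective f,
        {mono f : x y / (x <= y)%O} &
        forall i : 'I_k, covers (f (CrownA i)) (f (CrownC (ord_pred i)))].

(* Main.v *)
Require Import Defs.
From HB Require Import structures.
From mathcomp Require Import all_boot all_order.

(** Say that [a] must precede [a'] when [a < b < c] for some [b] and some [c]
covering [a'].  Let [L] be a linear extension that respects all these
precedences.  In a rainbow with more than [width P] covers, two of the upper
ends are comparable, say [b_j < b_i] with [i < j]; since [a_j < b_j < b_i] and
[b_i] covers [a_i], [a_j] must precede [a_i], whereas the rainbow puts [a_i]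
before [a_j].  So [L] has no such rainbow
([precedence_extension_no_rainbow]).

It remains to see that the order of [P] and the precedences together are
acyclic, so that [L] exists ([acyclic_linearization]).  A relation [x < y]
followed by a precedence from [y] is itself a precedence from [x], hence a
cycle can be turned into one that consists of precedences only
([must_precede_walk]).  Such a cycle contains a chordless one
([chordless_closed_walk]).  Its vertices, together with the elements [b] and
[c] that witness its precedences, form an embedded subdivided crown: any
further comparability between them would produce a chord
([chordless_crown]). *)

Set Implicit Arguments.
Unset Strict Implicit.
Unset Printing Implicit Defensive.

Import Order.TTheory.

(** * Closed walks and linearizations of a relation *)

(** A chord from [a i] to [a j] closes up the stretch of the walk that leads
from [a j] to [a i]; as that stretch is shorter, induction on the length
applies. *)
Lemma chordless_closed_walk (T : Type) (e : rel T) (n : nat) (a : 'I_n -> T) :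
    0 < n -> (forall i, e (a i) (a (ordS i))) ->
  exists k (c : 'I_k -> T),
    [/\ 0 < k, forall i, e (c i) (c (ordS i)) &
        forall i j, e (c i) (c j) -> j = ordS i].
Proof.
elim/ltn_ind: n a => -[|n] // IH a _ ae.
have [/forallP ch|] :=
    boolP [forall i, forall j, e (a i) (a j) ==> (j == ordS i)].
  exists n.+1, a; split=> // i j eij.
  by apply/eqP; have /forallP/(_ j)/implyP := ch i; apply.
case/forallPn=> i /forallPn[j]; rewrite negb_imply => /andP[eij nij].
(* The stretch from [a j] to [a i] takes [l] steps around the cycle. *)
set l := (i + (n.+1 - j)) %% n.+1.
have jl : (j + l) %% n.+1 = i.
  rewrite modnDmr addnCA subnKC; last exact/ltnW.
  by rewrite modnDr modn_small.
have ln : l.+1 < n.+1.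
  rewrite ltn_neqAle ltn_pmod // andbT eqSS.
  apply: contra nij => /eqP ln; apply/eqP/val_inj; rewrite /= -jl ln.
  by rewrite -(addn1 (_ %% _)) modnDml -addnA addn1 modnDr modn_small.
apply: (IH _ ln (fun t => a (inord ((j + t) %% n.+1)))) => // t.
(* All steps but the last are steps of [a]; the last one is the chord. *)
have [tl|] := ltnP t.+1 l.+1.
  rewrite /= (modn_small tl).
  have -> : inord ((j + t.+1) %% n.+1) =
            ordS (inord ((j + t) %% n.+1)) :> 'I_n.+1.
    apply: val_inj; rewrite /= !inordK ?ltn_pmod //.
    by rewrite -(addn1 (_ %% _)) modnDml addn1 addnS.
  exact: ae.
rewrite ltnS => lt; have tE : t = l :> nat.
  by apply/eqP; rewrite eqn_leq lt -ltnS ltn_ord.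
by rewrite /= tE modnn addn0 jl modn_small // !inord_val.
Qed.

Lemma connect_closed_walk (T : finType) (e : rel T) (x y : T) :
    e x y -> connect e y x ->
  exists n (a : 'I_n -> T), 0 < n /\ forall i, e (a i) (a (ordS i)).
Proof.
move=> exy /connectP[p yp xE].
exists (size p).+1, (fun i => nth y (y :: p) i); split=> // i.
have := ltn_ord i; rewrite ltnS leq_eqVlt => /orP[/eqP iE|ip].
  by rewrite /= iE modnn -last_nth -xE.
rewrite [nat_of_ord (ordS i)]/= modn_small //=.
by apply/(pathP y).
Qed.

(** [connect e] is a partial order, of which any linear extension will do. *)
Lemma acyclic_linearization (T : finType) (e : rel T) :
    (forall x y, e x y -> ~~ connect e y x) ->
  exists L : {set T * T},
    [/\ forall x, (x, x) \notin L,
        forall x y z, (x, y) \in L -> (y, z) \in L -> (x, z) \in L,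
        forall x y, x != y -> ((x, y) \in L) || ((y, x) \in L) &
        forall x y, e x y -> (x, y) \in L].
Proof.
move=> acyc.
have anti : antisymmetric (connect e).
  move=> x y /andP[/connectP[[|z p] //= /andP[xz zp] yE] yx].
  have zx : connect e z x.
    by apply: connect_trans yx; apply/connectP; exists p.
  by have := acyc _ _ xz; rewrite zx.
pose Q : finPOrderType (Order.Disp tt tt) :=
  HB.pack (Finite.sort T)
    (Order.Le_isPOrder.Build (Order.Disp tt tt) T
       (@connect0 _ e) anti (@connect_trans _ e)).
have [L /and4P[/forallP irr /forallP tr /forallP tot /forallP ext]] :=
  linear_extension_exists Q.
exists [set p : T * T | (p.1 : Q, p.2 : Q) \in L].
split=> [x|x y z|x y xy|x y xy]; rewrite !inE.
- exact: irr.
- move=> xy yz; have /forallP/(_ y)/forallP/(_ z)/implyP := tr x.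
  by apply; rewrite xy yz.
- by have /forallP/(_ y)/implyP := tot x; apply.
- have /forallP/(_ y)/implyP := ext x; apply.
  rewrite lt_neqAle; apply/andP; split; last exact: connect1.
  by apply: contraTneq (xy) => <-; apply/negP => /acyc; rewrite connect0.
Qed.

(** * Precedences *)

Section Precedence.
Context {d : Order.disp_t} {P : finPOrderType d}.
Implicit Types x y z a : P.

Definition must_precede a a' : bool :=
  [exists b, exists c, (a < b < c)%O && covers a' c].

Lemma must_precedeP a a' :
  reflect (exists b c, [/\ (a < b)%O, (b < c)%O & covers a' c])
          (must_precede a a').
Proof.
apply: (iffP existsP) => [[b /existsP[c /andP[/andP[ab bc] cov]]]|].
  by exists b, c.
by move=> [b [c [ab bc cov]]]; exists b; apply/existsP; exists c; rewrite ab bc.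
Qed.

Lemma must_precede_irr x : ~~ must_precede x x.
Proof.
apply/must_precedeP => -[b [c [xb bc /andP[_ /existsP[]]]]].
by exists b; rewrite xb.
Qed.

Lemma lt_must_precede x y z :
  (x < y)%O -> must_precede y z -> must_precede x z.
Proof.
move=> xy /must_precedeP[b [c [yb bc cov]]]; apply/must_precedeP.
by exists b, c; split=> //; apply: lt_trans yb.
Qed.

Definition lt_or_precede : rel P := [rel x y | (x < y)%O || must_precede x y].

(** Steps of the order are absorbed by the next precedence, if there is one. *)
Lemma connect_lt_or_precede x y : connect lt_or_precede x y ->
  exists2 z, connect must_precede x z & (z <= y)%O.
Proof.
case/connectP=> p + ->; elim: p x => [|u p IH] x /=.
  by move=> _; exists x; rewrite ?connect0.
case/andP=> xu /IH[z uz zy]; case/orP: xu => [xu|xu]; last first.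
  by exists z => //; apply: connect_trans (connect1 xu) uz.
case/connectP: uz => -[|v q] /= => [_ zE|/andP[uv vq] zE].
  by exists x => //; apply: le_trans (ltW xu) _; rewrite -{1}zE.
exists z => //; apply: connect_trans (connect1 (lt_must_precede xu uv)) _.
by apply/connectP; exists q.
Qed.

(** At least one step of the given cycle is a precedence, and it absorbs the
steps of the order that come before it around the cycle. *)
Lemma must_precede_walk x y : lt_or_precede x y -> connect lt_or_precede y x ->
  exists u v, must_precede u v /\ connect must_precede v u.
Proof.
move=> xy /connect_lt_or_precede[z yz zx]; case/orP: xy => [xy|xy].
  have zy := le_lt_trans zx xy.
  case/connectP: yz => -[|v q] /= => [_ zE|/andP[yv vq] zE].
    by rewrite zE ltxx in zy.
  exists z, v; split; first exact: lt_must_precede zy yv.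
  by apply/connectP; exists q.
exists z, y; split=> //; move: zx; rewrite le_eqVlt => /orP[/eqP->//|zx].
exact: lt_must_precede zx xy.
Qed.

(** An element strictly between [a i] and [c j] makes [a i] precede
[a (ordS j)], so that [i = j].  This rules out all comparabilities between
different indices that are absent from the crown, except [a i] being covered by
[c j]: then [a j] must precede [a i], so that the cover is diagonal. *)
Lemma chordless_crown k (a : 'I_k -> P) :
    (forall i, must_precede (a i) (a (ordS i))) ->
    (forall i j, must_precede (a i) (a j) -> j = ordS i) ->
  has_embedded_crown P k.
Proof.
move=> walk chordless.
have /fin_all_exists[b /fin_all_exists[c abc]] i := must_precedeP _ _ (walk i).
have ab i : (a i < b i)%O by have [] := abc i.
have bc i : (b i < c i)%O by have [] := abc i.
have ac i : (a i < c i)%O := lt_trans (ab i) (bc i).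
have cov i : covers (a (ordS i)) (c i) by have [] := abc i.
have between i j z : (a i < z)%O -> (z < c j)%O -> i = j.
  move=> az zc; apply/esym/(can_inj (@ordSK k))/chordless/must_precedeP.
  by exists z, (c j).
pose f (x : crown k) :=
  match x with CrownA i => a i | CrownB i => b i | CrownC i => c i end.
have f_diag i : covers (f (CrownA i)) (f (CrownC (ord_pred i))).
  by rewrite /= -{1}(ord_predK i).
have f_mono : {mono f : x y / (x <= y)%O}.
  move=> x y; rewrite [RHS]crown_leE; case: x y => [] i [] j /=.
  - apply/idP/eqP => [aij|-> //].
    exact: between (le_lt_trans aij (ab j)) (bc j).
  - apply/idP/eqP => [|->]; last exact/ltW.
    rewrite le_eqVlt => /orP[/eqP aE|aij]; last exact: between aij (bc j).
    by apply/esym/(between _ _ (a i)); rewrite // aE.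
  - apply/idP/orP => [|[/eqP->|/eqP->]]; last 2 first.
    + exact/ltW.
    + by have /andP[/ltW] := f_diag i.
    rewrite le_eqVlt => /orP[/eqP aE|aij].
      by left; apply/eqP/esym/(between _ _ (a i)); rewrite // aE.
    have [/existsP[z /andP[az zc]]|nz] := boolP [exists z, (a i < z < c j)%O].
      by left; rewrite (between _ _ _ az zc).
    right; apply/eqP/(can_inj (@ordSK k)); rewrite ord_predK.
    apply/esym/chordless/must_precedeP; exists (b j), (c j).
    by split=> //; apply/andP.
  - apply/negP => bij.
    have ij : i = j := between _ _ _ (ab i) (le_lt_trans bij (ac j)).
    by have := lt_le_trans (ab i) bij; rewrite ij ltxx.
  - apply/idP/eqP => [bij|-> //].
    exact: between (ab i) (le_lt_trans bij (bc j)).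
  - apply/idP/eqP => [|->]; last exact/ltW.
    rewrite le_eqVlt => /orP[/eqP bE|bij]; last exact: between (ab i) bij.
    by apply/esym/(between _ _ (b i)); rewrite // bE.
  - apply/negP => cij; have bij := lt_le_trans (bc i) cij.
    have ij : i = j := between _ _ _ (ab i) (lt_trans bij (ac j)).
    by have := lt_trans (ab i) bij; rewrite ij ltxx.
  - apply/negP => cij; have bij := lt_le_trans (bc i) cij.
    have ij : i = j := between _ _ _ (ab i) (lt_trans bij (bc j)).
    by rewrite ij ltxx in bij.
  - apply/idP/eqP => [cij|-> //].
    exact: between (ab i) (lt_le_trans (bc i) cij).
by exists f; split=> //; apply: inc_inj.
Qed.

Lemma precedence_acyclic :
    (forall k, 2 <= k -> ~ has_embedded_crown P k) ->
  forall x y, lt_or_precede x y -> ~~ connect lt_or_precede y x.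
Proof.
move=> no_crown x y xy; apply/negP => /(must_precede_walk xy)[u [v [uv vu]]].
have [n [a [n0 wa]]] := connect_closed_walk uv vu.
have [k [c [k0 wc chordless]]] := chordless_closed_walk n0 wa.
apply: (no_crown k); last exact: chordless_crown wc chordless.
(* A walk of length 1 would make an element precede itself. *)
case: k k0 c wc chordless => [|[|k]] // _ c wc _.
by have := wc ord0; rewrite [ordS _]ord1 (negbTE (must_precede_irr _)).
Qed.

(** * Rainbows *)

Lemma width_comparable (A : {set P}) : width P < #|A| ->
  exists x y, [/\ x \in A, y \in A & (x < y)%O].
Proof.
rewrite ltnNge => wA; have : ~~ antichain A.
  by apply: contra wA; apply: (@leq_bigmax_cond _ antichain (fun A => #|A|)).
case/forallPn=> x; rewrite negb_imply => /andP[xA].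
case/forallPn=> y; rewrite negb_imply => /andP[yA].
rewrite negb_imply negbK => /andP[xy] /comparable_ltgtP[lt|lt|eq].
- by exists x, y.
- by exists y, x.
- by rewrite eq eqxx in xy.
Qed.

(** The upper ends of a rainbow are pairwise distinct, so two of them are
comparable when there are more than [width P]. *)
Lemma precedence_extension_no_rainbow (L : {set P * P}) :
    linear_extension L ->
    (forall x y, must_precede x y -> (x, y) \in L) ->
  ~~ has_rainbow L (width P).+1.
Proof.
case/and4P=> /forallP irr /forallP tr _ /forallP ext prec.
have ltr : transitive [rel x y | (x, y) \in L].
  move=> y x z /= xy yz.
  by have /forallP/(_ y)/forallP/(_ z)/implyP := tr x; apply; rewrite xy.
have lirr : irreflexive [rel x y | (x, y) \in L].
  by move=> x /=; apply/negbTE.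
have asym x y : (x, y) \in L -> (y, x) \in L -> False.
  by move=> xy yx; have := ltr _ _ _ xy yx; rewrite lirr.
apply/existsP => -[a /existsP[b /andP[/forallP cov]]].
rewrite sorted_pairwise // pairwise_cat => /and3P[_ pa].
rewrite -sorted_pairwise // rev_sorted sorted_pairwise => [pb|y x z /= yx zy];
  last exact: ltr zy yx.
have x0 : P := tnth b ord0.
have anth := pairwiseP x0 pa; have bnth := pairwiseP x0 pb.
have bL (i j : 'I_(width P).+1) : i < j -> (tnth b j, tnth b i) \in L.
  move=> ij; rewrite !(tnth_nth x0).
  by apply: bnth => //; rewrite inE size_tuple.
have aL (i j : 'I_(width P).+1) : i < j -> (tnth a i, tnth a j) \in L.
  move=> ij; rewrite !(tnth_nth x0).
  by apply: anth => //; rewrite inE size_tuple.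
have b_inj : injective (tnth b).
  move=> i j bij; apply/val_inj.
  by case: (ltngtP i j) => // /bL; rewrite bij (negbTE (irr _)).
have [|x [y [/imsetP[j _ ->] /imsetP[i _ ->] ji]]] :=
    @width_comparable [set tnth b i | i : 'I_(width P).+1].
  by rewrite card_imset // card_ord.
have jiL : (tnth b j, tnth b i) \in L.
  by have /forallP/(_ (tnth b i))/implyP := ext (tnth b j); apply.
case: (ltngtP i j) => [ij|/bL/asym/(_ jiL)//|/val_inj ij]; last first.
  by rewrite ij ltxx in ji.
apply: asym (aL _ _ ij) (prec _ _ _); apply/must_precedeP.
by exists (tnth b j), (tnth b i); split=> //; have /andP[] := cov j.
Qed.

End Precedence.

Theorem theorem5 (d : Order.disp_t) (P : finPOrderType d)
    (P_nonempty : 0 < #|P|)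
    (no_crown : forall k : nat, 2 <= k -> ~ has_embedded_crown P k) :
  queue_number P <= width P.
Proof.
rewrite /queue_number; case: ex_minnP => m _; apply.
have [L [irr tr tot ext]] :=
  acyclic_linearization (precedence_acyclic no_crown).
have Lext : linear_extension L.
  apply/and4P; split; apply/forallP => x //; apply/forallP => y.
  - by apply/forallP => z; apply/implyP => /andP[]; apply: tr.
  - exact/implyP/tot.
  - by apply/implyP => xy; apply: ext; apply/orP; left.
apply/existsP; exists L; rewrite Lext /=.
apply: precedence_extension_no_rainbow => // x y xy.
by apply: ext; apply/orP; right.
Qed.
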